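(* The conversion matrices defined by $$\mathbf H^{(a,b,c,d)}=\mathbf H^{(a+1,b+1,c,d)}\,T_{(a,b,c,d)}^{(a+1,b+1,c,d)},\qquad \mathbf H^{(a,b,c,d)}=\mathbf H^{(a,b,c+1,d+1)}\,T_{(a,b,c,d)}^{(a,b,c+1,d+1)},$$ $$\mathbf W^{(a,b,c,d)}=\mathbf W^{(a-1,b-1,c,d)}\,T_{W,(a,b,c,d)}^{(a-1,b-1,c,d)},\qquad \mathbf W^{(a,b,c,d)}=\mathbf W^{(a,b,c-1,d-1)}\,T_{W,(a,b,c,d)}^{(a,b,c-1,d-1)}$$ are sparse, with banded-block-banded structure. More specifically: - $T_{(a,b,c,d)}^{(a+1,b+1,c,d)}$ has block-bandwidths $(0,2)$ and each block has bandwidths $(0,0)$. - $T_{(a,b,c,d)}^{(a,b,c+1,d+1)}$ has block-bandwidths $(\deg\rho^2-2,\deg\rho^2)$ and each block has bandwidths $(0,2)$. - $T_{W,(a,b,c,d)}^{(a-1,b-1,c,d)}$ has block-bandwidths $(2,0)$ and each block has bandwidths $(0,0)$. - $T_{W,(a,b,c,d)}^{(a,b,c-1,d-1)}$ has block-bandwidths $(\deg\rho^2,\deg\rho^2-2)$ and each block has bandwidths $(2,0)$.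
   Context: Setting. Let $\alpha<\beta$ and $\gamma<\delta$ be real, and let $\rho$ be a function on $[\alpha,\beta]$, positive on $(\alpha,\beta)$, with either: case (i), $\rho$ is a polynomial of degree $d_0$ (so $\deg\rho^2=2d_0$); or case (ii), $\rho$ is the square root of a polynomial of degree $d_1=\deg\rho^2$ and $\delta=-\gamma>0$. Put $\eta=0$ in case (i), $\eta=1$ in case (ii), so $d_\eta=\deg\rho^{1+\eta}$; assume $d_\eta\ge 2+\eta$. Let $\Omega=\{(x,y):\alpha\le x\le\beta,\ \gamma\rho(x)\le y\le\delta\rho(x)\}$. All parameters are real with $c=d$ in case (ii), and in every family $\mathbf H^{(\cdot)}$, $\mathbf W^{(\cdot)}$ that appears (including the decremented ones) the parameters are $>-1$ and the weights integrable. Polynomials. $w_R^{(a,b,s)}(x)=(\beta-x)^a(x-\alpha)^b\rho(x)^s$ on $[\alpha,\beta]$, and $R_n^{(a,b,s)}$ ($n\ge0$) are the orthonormal polynomials (degree $n$, positive leading coefficient) for this weight. $w_P^{(d,c)}(y)=(\delta-y)^d(y-\gamma)^c$ on $[\gamma,\delta]$, with orthonormal polynomials $\widetilde P_n^{(d,c)}$. The generalised Koornwinder polynomials are $$H_{n,k}^{(a,b,c,d)}(x,y)=R_{n-k}^{(a,b,c+d+2k+1)}(x)\,\rho(x)^k\,\widetilde P_k^{(d,c)}(y/\rho(x)),\quad 0\le k\le n,$$ orthonormal on $\Omega$ with respect to $W^{(a,b,c,d)}(x,y)=(\beta-x)^a(x-\alpha)^b(y-\gamma\rho(x))^c(\delta\rho(x)-y)^d$.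 $\mathbf H^{(a,b,c,d)}$ is the infinite row vector of all $H_{n,k}^{(a,b,c,d)}$, ordered in blocks $n=0,1,2,\dots$, block $n$ being $(H_{n,0},\dots,H_{n,n})$, and $\mathbf W^{(a,b,c,d)}=W^{(a,b,c,d)}\mathbf H^{(a,b,c,d)}$. Conventions. $A_{[i,j]}$ is the entry in row $i+1$, column $j+1$ of $A$. A matrix has bandwidths $(\sigma,\mu)$ if $A_{[i,j]}=0$ whenever $i-j>\sigma$ or $j-i>\mu$; block-bandwidths are defined in the same way, with block $(i,j)$ (of size $(i+1)\times(j+1)$) in place of entry $[i,j]$, and ''each block has bandwidths'' refers to bandwidths within the blocks. ''Banded-block-banded'' means finite block-bandwidths with uniformly banded blocks. *)

(* Defs.v *)
From HB Require Import structures.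
From mathcomp Require Import all_boot all_order all_algebra.
From mathcomp Require Import all_classical all_reals all_analysis.

Set Implicit Arguments.
Unset Strict Implicit.
Unset Printing Implicit Defensive.

Import Order.TTheory GRing.Theory Num.Theory.
Import numFieldNormedType.Exports.

Local Open Scope classical_set_scope.
Local Open Scope ring_scope.

Section Polynomials.
Variable R : realType.
Implicit Types (p q : {poly R}) (w : R -> R).

Definition deg p : nat := (size p).-1.

(* [P n] is the orthonormal polynomial of degree n, with positive leading
   coefficient, for the weight w on [lo, hi]; these conditions determine P. *)
Definition orthonormal_polys (lo hi : R) w (P : nat -> {poly R}) : Prop :=
  [/\ forall n, size (P n) = n.+1,
      forall n, 0 < lead_coef (P n)
    & forall m n,
        (\int[lebesgue_measure]_(x in `[lo, hi])
           ((P m).[x] * (P n).[x] * w x)%:E = ((m == n)%:R)%:E)%E].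

Definition weight_integrable (lo hi : R) w : Prop :=
  lebesgue_measure.-integrable `[lo, hi] (fun x => (w x)%:E).

End Polynomials.

Section Koornwinder.
Variable R : realType.
Variables alpha beta gamma delta : R.
Variable rho : R -> R.

(* The polynomial r is rho ^ (1 + eta): eta = false is case (i), where rho
   itself is a polynomial on [alpha, beta], and eta = true is case (ii), where
   rho is the square root of a polynomial. *)
Definition rho_case (eta : bool) (r : {poly R}) : Prop :=
  if eta then
    [/\ forall x, alpha <= x <= beta -> rho x = Num.sqrt r.[x],
        delta = - gamma & 0 < delta]
  else forall x, alpha <= x <= beta -> rho x = r.[x].

(* The polynomial rho ^ 2, given r = rho ^ (1 + eta). *)
Definition rho_sq (eta : bool) (r : {poly R}) : {poly R} :=
  if eta then r else r ^+ 2.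

Definition Omega : set (R * R) :=
  [set z | alpha <= z.1 <= beta /\ gamma * rho z.1 <= z.2 <= delta * rho z.1].

(* The weights may be infinite on the boundary of Omega, so identities between
   weighted families are only imposed in the interior. *)
Definition Omega_int : set (R * R) :=
  [set z | alpha < z.1 < beta /\ gamma * rho z.1 < z.2 < delta * rho z.1].

Definition wR (a b s x : R) : R :=
  (beta - x) `^ a * (x - alpha) `^ b * (rho x) `^ s.

Definition wP (d c y : R) : R := (delta - y) `^ d * (y - gamma) `^ c.

Definition weight (a b c d : R) (z : R * R) : R :=
  (beta - z.1) `^ a * (z.1 - alpha) `^ b
  * (z.2 - gamma * rho z.1) `^ c * (delta * rho z.1 - z.2) `^ d.

(* Standing assumptions on a family with parameters (a, b, c, d). *)
Definition admissible (a b c d : R) : Prop :=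
  [/\ [/\ -1 < a, -1 < b, -1 < c & -1 < d],
      (lebesgue_measure \x lebesgue_measure)%E.-integrable Omega
        (fun z => (weight a b c d z)%:E),
      forall k : nat,
        weight_integrable alpha beta (wR a b (c + d + (2 * k + 1)%:R))
    & weight_integrable gamma delta (wP d c)].

(* Block row vectors of functions: [F n z] is the value at z of block n, which
   has length n + 1. *)
Definition block_row := forall n : nat, R * R -> 'rV[R]_n.+1.

(* [RR a b s n] and [PP d c k] stand for the univariate polynomials
   R_n^(a,b,s) and P_k^(d,c).  Where rho vanishes, y / rho x is 0 by convention;
   on Omega this only concerns points with y = 0, where it gives the value 0
   for k > 0, as for the polynomial rho^k P_k(y / rho) in (rho, y). *)
Definition koornwinder (RR : R -> R -> R -> nat -> {poly R})
    (PP : R -> R -> nat -> {poly R}) (a b c d : R) : block_row :=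
  fun n z => \row_(k < n.+1)
    ((RR a b (c + d + (2 * k + 1)%:R) (n - k)%N).[z.1]
     * rho z.1 ^+ k * (PP d c k).[z.2 / rho z.1]).

Definition weighted_koornwinder (RR : R -> R -> R -> nat -> {poly R})
    (PP : R -> R -> nat -> {poly R}) (a b c d : R) : block_row :=
  fun n z => weight a b c d z *: koornwinder RR PP a b c d n z.

End Koornwinder.

Section BlockMatrices.
Variable R : realType.

Definition block_matrix := forall i j : nat, 'M[R]_(i.+1, j.+1).

(* In [bandwidths] and [block_bandwidths] the subtractions are truncated, which
   is harmless since the bounds are nonnegative. *)
Definition bandwidths (s u m n : nat) (A : 'M[R]_(m, n)) : Prop :=
  forall (i : 'I_m) (j : 'I_n), (s < i - j)%N || (u < j - i)%N -> A i j = 0.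

Definition block_bandwidths (s u : nat) (T : block_matrix) : Prop :=
  forall i j : nat, (s < i - j)%N || (u < j - i)%N -> T i j = 0.

Definition blocks_bandwidths (s u : nat) (T : block_matrix) : Prop :=
  forall i j : nat, bandwidths s u (T i j).

Definition banded_block_banded (T : block_matrix) : Prop :=
  (exists s u, block_bandwidths s u T) /\ (exists s u, blocks_bandwidths s u T).

(* F = G T on D.  Each block column of T has finitely many nonzero blocks, so
   that the infinite matrix product makes sense. *)
Definition conversion_matrix (D : set (R * R)) (F G : block_row R)
    (T : block_matrix) : Prop :=
  forall n, exists N : nat,
    (forall m, (N <= m)%N -> T m n = 0) /\
    (forall z, D z -> F n z = \sum_(m < N) G m z *m T m n).

(* The equation F = G T on D defines a matrix T, which is banded-block-banded
   with block-bandwidths (s, u) and blocks of bandwidths (s', u'). *)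
Definition banded_conversion (D : set (R * R)) (F G : block_row R)
    (s u s' u' : nat) : Prop :=
  (exists! T, conversion_matrix D F G T) /\
  (forall T, conversion_matrix D F G T ->
     [/\ banded_block_banded T, block_bandwidths s u T
       & blocks_bandwidths s' u' T]).

End BlockMatrices.

(* Main.v *)
Require Import Defs.
From HB Require Import structures.
From mathcomp Require Import all_boot all_order all_algebra.
From mathcomp Require Import all_classical all_reals all_analysis.
From mathcomp Require Import measurable_realfun ring lra zify.

Set Implicit Arguments.
Unset Strict Implicit.
Unset Printing Implicit Defensive.

Import Order.TTheory GRing.Theory Num.Theory.
Import numFieldNormedType.Exports.

Local Open Scope classical_set_scope.
Local Open Scope ring_scope.

(** Write t = y / rho(x).  The entry (n, k) of the Koornwinder row is
    R_(n-k)(x) rho(x)^k P_k(t), where the weight of R_(n-k) carries the exponent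
    s_k = c + d + 2k + 1 of rho.  Every conversion is a product of two univariate
    conversions, one in t and one in x, and each of these is banded by
    orthogonality.

    The univariate principle ([connection_expansion], [connection_high] and
    [connection_low]) is the following.  Let P and P' be the orthonormal
    polynomials for the weights w and w', and let u, v be polynomials with
    u w' = v w on the interval.  Then u P_n is a combination of P'_0, ...,
    P'_(n + deg u), and its coefficient on P'_j is the integral of
    u P_n P'_j w' = P_n (v P'_j) w, which vanishes when deg v + j < n.

    Changing (a, b) by one only concerns x: u and v are 1 and
    (beta - x)(x - alpha), in the order that depends on whether the parameters
    grow or, for the weighted families, decrease ([side_conversion]).

    Changing (c, d) first expands P_k, or (delta - t)(t - gamma) P_k for the
    weighted families, in the P'_l.  With tau = 0, or tau = 2 in the weighted
    case, only the l with 0 <= e <= 2 occur, where e = k + tau - l.  The factor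
    rho^(k + tau) = rho^e rho^l leaves rho^e R_i to be expanded in the R'_j, and
    the exponents of rho in the two weights are such that
    rho^e w' = rho^(2 - e) w.  For e = 0 and e = 2 both factors are polynomials.
    For e = 1 both are rho itself: in case (i) this is a polynomial, and in
    case (ii) the P-coefficient vanishes because c = d and delta = - gamma make
    the P_k even or odd ([connection_parity]).  The block-bandwidths come out of
    the single estimate deg rho^e <= e + deg rho^2 - 2 ([size_rho_pow]), which is
    where the lower bound on the degree of rho enters ([curve_conversion]).

    The matrix T is unique because the functions in a Koornwinder row are
    linearly independent on the interior of the domain: for fixed x a vanishing
    combination is a polynomial in t with infinitely many zeros, and its
    coefficients are then polynomials in x with infinitely many zeros
    ([koornwinder_free]). *)

(** * Families of polynomials of every degree *)

Section GradedFamilies.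
Variables (F : fieldType) (P : nat -> {poly F}).
Hypothesis size_P : forall n, size (P n) = n.+1.

Let top_coef_neq0 M : (P M)`_M != 0.
Proof.
rewrite -[X in _`_X]/(M.+1.-1) -size_P -lead_coefE lead_coef_eq0.
by rewrite -size_poly_gt0 size_P.
Qed.

(** Subtracting the right multiple of the member of top degree lowers the
    degree. *)
Lemma graded_span M (p : {poly F}) : (size p <= M)%N ->
  exists c : nat -> F, p = \sum_(j < M) c j *: P j.
Proof.
elim: M p => [|M IHM] p szp.
  by exists (fun=> 0); rewrite big_ord0; apply/eqP; rewrite -size_poly_leq0.
have lead_neq0 := top_coef_neq0 M.
pose e := p`_M / (P M)`_M.
have [|c pE] := IHM (p - e *: P M).
  apply/leq_sizeP => j; rewrite leq_eqVlt => /predU1P[<-|ltMj].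
    by rewrite coefB coefZ divfK// subrr.
  by rewrite coefB coefZ !nth_default ?mulr0 ?subr0 ?size_P// (leq_trans szp).
exists (fun j => if j == M then e else c j).
rewrite big_ord_recr/= eqxx -[LHS](subrK (e *: P M)) pE; congr (_ + _).
by apply: eq_bigr => i _; rewrite ltn_eqF.
Qed.

(** Only the member of top degree contributes to the top coefficient. *)
Lemma graded_free M (c : nat -> F) : \sum_(j < M) c j *: P j = 0 ->
  forall j, (j < M)%N -> c j = 0.
Proof.
elim: M => [|M IHM]//; rewrite big_ord_recr/= => sum0.
have cM : c M = 0.
  have lead_neq0 := top_coef_neq0 M.
  have low0 : (\sum_(j < M) c j *: P j)`_M = 0.
    by rewrite coef_sum big1// => i _; rewrite coefZ nth_default ?mulr0// size_P.
  have /eqP := congr1 (fun p : {poly F} => p`_M) sum0.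
  by rewrite /= coefD coefZ low0 add0r coef0 mulf_eq0 (negPf lead_neq0) orbF => /eqP.
move=> j; rewrite ltnS leq_eqVlt => /predU1P[->//|]; apply: IHM.
by rewrite cM scale0r addr0 in sum0.
Qed.

End GradedFamilies.

Section PolynomialsOnIntervals.
Variable R : realType.
Implicit Types (p : {poly R}) (lo hi : R).

Lemma poly_eq0_itv p lo hi : lo < hi ->
  (forall x, lo < x < hi -> p.[x] = 0) -> p = 0.
Proof.
move=> lohi p0; apply/eqP/contraT => p_neq0.
pose x i : R := lo + (hi - lo) / (i.+2)%:R.
have := max_poly_roots (rs := [seq x i | i <- iota 0 (size p)]) p_neq0.
rewrite size_map size_iota ltnn => -> //.
  apply/allP => _ /mapP[i _ ->]; apply/rootP/p0; rewrite /x.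
  rewrite ltrDl divr_gt0 ?subr_gt0//= -ltrBrDl ltr_pdivrMr// ltr_pMr ?subr_gt0//.
  by rewrite ltr1n.
rewrite map_inj_uniq ?iota_uniq// => i j /addrI/mulfI.
move=> /(_ (lt0r_neq0 _)) /invr_inj/eqP; rewrite subr_gt0 eqr_nat => /(_ lohi).
by move=> /eqP[].
Qed.

(** At a point where p is negative, the intermediate value theorem would give a
    zero of p strictly between that point and the midpoint.  The end points matter
    because the weights and the conversion identities include them. *)
Lemma poly_ge0_closure p lo hi : lo < hi ->
  (forall x, lo < x < hi -> 0 < p.[x]) -> forall x, lo <= x <= hi -> 0 <= p.[x].
Proof.
move=> lohi p_gt0 x xI; rewrite leNgt; apply/negP => px.
pose m := (lo + hi) / 2; have mI : lo < m < hi by rewrite /m; lra.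
have root_not y : lo < y < hi -> ~~ root p y.
  by move=> /p_gt0/lt0r_neq0.
have pm := p_gt0 m mI.
have [lexm|ltmx] := leP x m.
  have [|y yI rooty] := @poly_ivt _ p x m lexm; first by rewrite !ltW.
  have xy : x != y by apply: contraTneq px => ->; rewrite (rootP rooty) ltxx.
  by have /negP := root_not y ltac:(move: xy; rewrite neq_lt; lra).
have [|y yI rooty] := @poly_ivt _ (- p) m x (ltW ltmx).
  by rewrite !hornerN oppr_le0 oppr_ge0 !ltW.
rewrite rootN in rooty.
have xy : x != y by apply: contraTneq px => ->; rewrite (rootP rooty) ltxx.
by have /negP := root_not y ltac:(move: xy; rewrite neq_lt; lra).
Qed.

End PolynomialsOnIntervals.

(** * Integration of polynomials against a weight *)

Section Moments.
Variable R : realType.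
Implicit Types (lo hi : R) (w : R -> R) (p q u v : {poly R}).

Definition moment lo hi w p : R :=
  \int[lebesgue_measure]_(x in `[lo, hi]) (p.[x] * w x).

(** A polynomial is bounded on a compact interval, so that the integrability of
    the weight is all that linearity of the moments requires. *)
Lemma horner_weight_integrable lo hi w p : weight_integrable lo hi w ->
  lebesgue_measure.-integrable `[lo, hi] (EFin \o (fun x => p.[x] * w x)).
Proof.
move=> wint; apply: (@integrableMr _ _ _ lebesgue_measure _ _ (horner p)) wint => //.
  exact: measurable_poly.
have /compact_bounded : compact (horner p @` `[lo, hi]).
  apply: continuous_compact; last exact: segment_compact.
  exact/continuous_subspaceT/continuous_horner.
move=> [M [Mreal MP]]; exists M; split => // y /MP pM x /= xI.
by apply: pM; exists x.
Qed.

Section FixedWeight.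
Variables (lo hi : R) (w : R -> R).
Hypothesis wint : weight_integrable lo hi w.

Lemma momentD p q : moment lo hi w (p + q) = moment lo hi w p + moment lo hi w q.
Proof.
rewrite /moment -RintegralD//; try exact: horner_weight_integrable.
by apply: eq_Rintegral => x _; rewrite hornerD mulrDl.
Qed.

Lemma momentZ e p : moment lo hi w (e *: p) = e * moment lo hi w p.
Proof.
rewrite /moment -RintegralZl//; last exact: horner_weight_integrable.
by apply: eq_Rintegral => x _; rewrite hornerZ mulrA.
Qed.

Lemma moment0 : moment lo hi w 0 = 0.
Proof. by rewrite -(scale0r 0) momentZ mul0r. Qed.

Lemma moment_sum (I : finType) (q : I -> {poly R}) :
  moment lo hi w (\sum_i q i) = \sum_i moment lo hi w (q i).
Proof. exact: (big_morph _ momentD moment0). Qed.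

End FixedWeight.

Lemma eq_moment lo hi w w' u v q :
  {in `[lo, hi], forall x, u.[x] * w' x = v.[x] * w x} ->
  moment lo hi w' (u * q) = moment lo hi w (v * q).
Proof.
move=> uv; apply: eq_Rintegral => x; rewrite inE/= => xI.
by rewrite !hornerM mulrAC uv// mulrAC.
Qed.

(** Lebesgue measure is invariant under negation. *)
Lemma moment_reflect (h : R) w p : measurable_fun setT w ->
  (forall x, w (- x) = w x) -> weight_integrable (- h) h w ->
  moment (- h) h w (p \Po (- 'X)) = moment (- h) h w p.
Proof.
move=> mw weven wint.
pose f x := (p.[x] * w x)%:E.
have fE : f \o -%R = fun x => ((p \Po (- 'X)).[x] * w x)%:E.
  by apply/funext => x; rewrite /f/= horner_comp !hornerE weven.
pose D : set R := `[- h, h]%classic.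
have itvN : (-%R : R -> measurableTypeR R) @^-1` D = D.
  by rewrite opp_preimage_itvbndbnd/= opprK.
have mD : measurable D by exact: measurable_itv.
rewrite /moment /Rintegral -/D; congr fine; apply: esym.
transitivity (\int[pushforward lebesgue_measure
    (-%R : R -> measurableTypeR R)]_(x in D) f x)%E.
  by apply: eq_measure_integral => A mA _; apply/esym/lebesgue_measureN.
rewrite integral_pushforward//; last 2 first.
- apply/measurable_EFinP/measurable_funM => //.
  exact: measurable_poly.
- by rewrite itvN fE; exact: horner_weight_integrable.
by rewrite itvN fE.
Qed.

End Moments.

(** * Connection coefficients between orthonormal families *)

Section Connection.
Variable R : realType.
Implicit Types (lo hi : R) (w : R -> R) (p q u v : {poly R}).

Section Expansion.
Variables (lo hi : R) (w : R -> R) (P : nat -> {poly R}).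
Hypothesis wint : weight_integrable lo hi w.
Hypothesis P_on : orthonormal_polys lo hi w P.

Let size_P n : size (P n) = n.+1. Proof. by case: P_on. Qed.

Lemma moment_orthonormal m n : moment lo hi w (P m * P n) = (m == n)%:R.
Proof.
have [_ _ /(_ m n)] := P_on; rewrite /moment /Rintegral.
by move=> ortho; under eq_integral do rewrite hornerM; rewrite ortho.
Qed.

Lemma orthonormal_expansion M p : (size p <= M)%N ->
  p = \sum_(j < M) moment lo hi w (p * P j) *: P j.
Proof.
move=> /(graded_span size_P)[c pE]; rewrite [LHS]pE.
apply: eq_bigr => j _; congr (_ *: _).
rewrite pE mulr_suml moment_sum// (bigD1 j)//= -scalerAl momentZ//.
rewrite moment_orthonormal eqxx mulr1 big1 ?addr0// => i /negPf ij.
by rewrite -scalerAl momentZ// moment_orthonormal -[(_ == _ :> nat)]/(i == j) ij mulr0.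
Qed.

Lemma moment_low_degree p n : (size p <= n)%N -> moment lo hi w (p * P n) = 0.
Proof.
move=> /orthonormal_expansion ->; rewrite mulr_suml moment_sum// big1// => i _.
by rewrite -scalerAl momentZ// moment_orthonormal ltn_eqF ?mulr0.
Qed.

End Expansion.

(** When w' is the weight of P', this is the coefficient of P'_j in u P_n. *)
Definition connection lo hi w' u (P P' : nat -> {poly R}) j n : R :=
  moment lo hi w' (u * P n * P' j).

Variables (lo hi : R) (w w' : R -> R) (P P' : nat -> {poly R}) (u v : {poly R}).
Hypotheses (wint : weight_integrable lo hi w)
  (wint' : weight_integrable lo hi w').
Hypotheses (P_on : orthonormal_polys lo hi w P)
  (P_on' : orthonormal_polys lo hi w' P').

Local Notation C := (connection lo hi w' u P P').

Let size_P n : size (P n) = n.+1. Proof. by case: P_on. Qed.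
Let size_P' n : size (P' n) = n.+1. Proof. by case: P_on'. Qed.

Lemma connection_expansion M n : (size u + n <= M)%N ->
  u * P n = \sum_(j < M) C j n *: P' j.
Proof.
move=> leM; apply: orthonormal_expansion => //; apply: leq_trans leM.
by rewrite (leq_trans (size_polyMleq _ _))// size_P addnS.
Qed.

Lemma connection_high j n : (size u + n <= j)%N -> C j n = 0.
Proof.
move=> lej; apply: moment_low_degree => //; apply: leq_trans lej.
by rewrite (leq_trans (size_polyMleq _ _))// size_P addnS.
Qed.

Hypothesis uv : {in `[lo, hi], forall x, u.[x] * w' x = v.[x] * w x}.

(** The integral of u P_n P'_j w' is that of P_n (v P'_j) w, and P_n is
    orthogonal to every polynomial of lower degree. *)
Lemma connection_low j n : (size v + j <= n)%N -> C j n = 0.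
Proof.
move=> len; rewrite /connection -mulrA (eq_moment _ uv) mulrCA mulrC.
apply: (@moment_low_degree _ _ w) => //; apply: leq_trans len.
by rewrite (leq_trans (size_polyMleq _ _))// size_P' addnS.
Qed.

End Connection.

Lemma connection_horner (R : realType) (lo hi : R) (w w' : R -> R)
    (u : {poly R}) (P P' : nat -> {poly R}) M n x :
  weight_integrable lo hi w' -> orthonormal_polys lo hi w P ->
  orthonormal_polys lo hi w' P' -> (size u + n <= M)%N ->
  u.[x] * (P n).[x] = \sum_(j < M) connection lo hi w' u P P' j n * (P' j).[x].
Proof.
move=> wint' P_on P_on' leM.
rewrite -hornerM (connection_expansion wint' P_on P_on' leM) horner_sum.
by apply: eq_bigr => j _; rewrite hornerZ.
Qed.

(** * Parity for even weights *)

Section Parity.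
Variables (R : realType) (h : R).

Lemma size_comp_polyN (p : {poly R}) : size (p \Po (- 'X)) = size p.
Proof. by rewrite size_comp_poly2// size_polyN size_polyX. Qed.

(** P_n(-x) is again orthogonal to all polynomials of degree below n, hence a
    multiple of P_n; comparing leading coefficients gives the sign. *)
Lemma orthonormal_parity (w : R -> R) (P : nat -> {poly R}) n :
  measurable_fun setT w -> (forall x, w (- x) = w x) ->
  weight_integrable (- h) h w ->
  orthonormal_polys (- h) h w P -> P n \Po (- 'X) = (-1) ^+ n *: P n.
Proof.
move=> mw weven wint P_on; have [size_P _ _] := P_on.
have NXK (p : {poly R}) : (p \Po (- 'X)) \Po (- 'X) = p.
  by rewrite -comp_polyA linearN/= comp_polyX opprK comp_polyXr.
pose e := moment (- h) h w ((P n \Po (- 'X)) * P n).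
have PE : P n \Po (- 'X) = e *: P n.
  rewrite [LHS](orthonormal_expansion wint P_on (M := n.+1)) ?size_comp_polyN ?size_P//.
  rewrite big_ord_recr/= big1 ?add0r// => j _.
  rewrite -(moment_reflect _ mw weven wint) comp_polyM NXK mulrC.
  by rewrite (moment_low_degree wint P_on) ?scale0r// size_comp_polyN size_P.
have lead_neq0 : lead_coef (P n) != 0 by rewrite lead_coef_eq0 -size_poly_gt0 size_P.
rewrite PE; congr (_ *: _); apply: (mulIf lead_neq0).
rewrite -lead_coefZ -PE lead_coef_comp ?size_polyN ?size_polyX//.
by rewrite lead_coefN lead_coefX size_P mulrC.
Qed.

(** The integrand is odd. *)
Lemma connection_parity (w w' : R -> R) (u : {poly R}) (P P' : nat -> {poly R}) j n :
  measurable_fun setT w -> (forall x, w (- x) = w x) ->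
  weight_integrable (- h) h w ->
  measurable_fun setT w' -> (forall x, w' (- x) = w' x) ->
  weight_integrable (- h) h w' -> u \Po (- 'X) = u ->
  orthonormal_polys (- h) h w P -> orthonormal_polys (- h) h w' P' ->
  odd (j + n) -> connection (- h) h w' u P P' j n = 0.
Proof.
move=> mw weven wint mw' weven' wint' uN P_on P_on' odd_jn.
have : connection (- h) h w' u P P' j n = - connection (- h) h w' u P P' j n.
  rewrite {1}/connection -(moment_reflect _ mw' weven' wint') !comp_polyM uN.
  rewrite (orthonormal_parity _ mw weven wint P_on).
  rewrite (orthonormal_parity _ mw' weven' wint' P_on').
  rewrite -!scalerAr -scalerAl scalerA momentZ//.
  by rewrite -exprD -signr_odd odd_jn expr1 mulN1r.
move=> /eqP; rewrite -subr_eq0 opprK -mulr2n mulrn_eq0 /= => /eqP //.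
Qed.

End Parity.

(** * From scalar coefficients to block matrices *)

Section BlockAssembly.
Variable R : realType.
Implicit Types (D : set (R * R)) (f g : nat -> nat -> R * R -> R).

(** Entry k of block n is indexed by the pair of degrees (k, n - k) rather than by
    (n, k), so that the ranges of the two univariate expansions are independent. *)
Definition block_row_of f : block_row R :=
  fun n z => \row_(k < n.+1) f k (n - k)%N z.

Lemma sum_by_total_degree (V : nmodType) (N : nat) (h : nat -> nat -> V) :
  \sum_(m < N) \sum_(l < m.+1) h l (m - l)%N =
  \sum_(l < N) \sum_(j < N - l) h l j.
Proof.
elim: N => [|N IHN]; first by rewrite !big_ord0.
rewrite big_ord_recr/= IHN.
under [RHS]eq_bigr => l _ do rewrite subSn ?leq_ord// big_ord_recr/=.
by rewrite big_split/= [X in _ = X + _]big_ord_recr/= subnn big_ord0 addr0.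
Qed.

(** C l k j i is the coefficient on the target function with degrees (l, j) of the
    source function with degrees (k, i).  It sits in block (l + j, k + i), at
    position (l, k) of that block, which explains the four inequalities. *)
Lemma banded_conversion_coef D f g (C : nat -> nat -> nat -> nat -> R)
    (s u s' u' : nat) :
  (forall N (c : nat -> nat -> R),
     (forall z, D z -> \sum_(l < N) \sum_(j < N - l) c l j * g l j z = 0) ->
     forall l j, (l + j < N)%N -> c l j = 0) ->
  (forall l k j i, C l k j i != 0 ->
     [/\ (l + j <= k + i + s)%N, (k + i <= l + j + u)%N,
         (l <= k + s')%N & (k <= l + u')%N]) ->
  (forall k i N z, (k + i + s < N)%N -> D z ->
     f k i z = \sum_(l < N) \sum_(j < N - l) C l k j i * g l j z) ->
  banded_conversion D (block_row_of f) (block_row_of g) s u s' u'.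
Proof.
move=> g_free C_band fE.
pose T : block_matrix R := fun m n => \matrix_(l, k) C l k (m - l)%N (n - k)%N.
have T_block : block_bandwidths s u T.
  move=> m n mn; apply/matrixP => l k; rewrite !mxE.
  apply/eqP/contraT => /C_band[]; have := ltn_ord l; have := ltn_ord k; lia.
have T_blocks : blocks_bandwidths s' u' T.
  move=> m n l k lk; rewrite !mxE.
  apply/eqP/contraT => /C_band[]; have := ltn_ord l; have := ltn_ord k; lia.
have T_conv : conversion_matrix D (block_row_of f) (block_row_of g) T.
  move=> n; exists (n + s).+1; split=> [m ltm|z Dz]; first by apply: T_block; lia.
  apply/rowP => k; rewrite mxE summxE (fE _ _ (n + s).+1 z)//; last first.
    by have := ltn_ord k; lia.
  rewrite -(sum_by_total_degree _ (fun l j => C l k j (n - k)%N * g l j z)).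
  by apply: eq_bigr => m _; rewrite mxE; apply: eq_bigr => l _; rewrite !mxE mulrC.
clearbody T; clear fE C_band.
have T_unique T' : conversion_matrix D (block_row_of f) (block_row_of g) T' -> T = T'.
  move=> T'_conv; apply: functional_extensionality_dep => m.
  apply: functional_extensionality_dep => n.
  have [N [T0 TE]] := T_conv n; have [N' [T'0 T'E]] := T'_conv n.
  (* Both finite expansions of column block n, and block m, fit in size M. *)
  pose M := maxn m.+1 (maxn N N').
  have ext (X : block_matrix R) K z : (K <= M)%N ->
      (forall m, (K <= m)%N -> X m n = 0) ->
      \sum_(m < M) block_row_of g m z *m X m n =
      \sum_(m < K) block_row_of g m z *m X m n.
    move=> leKM X0; rewrite -!(big_mkord predT (fun m => block_row_of g m z *m X m n)).
    rewrite (big_cat_nat (n := K))//= [X in _ + X]big1_seq ?addr0// => i.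
    by rewrite mem_index_iota => /and3P[_ /X0-> _]; rewrite mulmx0.
  have leNM : (N <= M)%N by rewrite /M; lia.
  have leN'M : (N' <= M)%N by rewrite /M; lia.
  apply/matrixP => l k.
  pose c l j := T (l + j)%N n (inord l) k - T' (l + j)%N n (inord l) k.
  have lem : (l <= m)%N by rewrite -ltnS ltn_ord.
  suff : c l (m - l)%N = 0.
    by rewrite /c subnKC// inord_val => /eqP; rewrite subr_eq0 => /eqP.
  apply: (g_free M); last by rewrite /M; lia.
  move=> z Dz; rewrite -(sum_by_total_degree _ (fun l j => c l j * g l j z)).
  have := congr1 (fun r : 'rV_n.+1 => r 0 k) (etrans (esym (TE z Dz)) (T'E z Dz)).
  rewrite -(ext T N)// -(ext T' N')// !summxE => /eqP.
  rewrite -subr_eq0 -sumrB => /eqP sum0.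
  rewrite -[RHS]sum0; apply: eq_bigr => i _; rewrite !mxE -sumrB.
  apply: eq_bigr => j _; rewrite !mxE /c subnKC ?leq_ord// inord_val.
  by ring.
split; first by exists T.
move=> T' /T_unique <-; split => //; split; [by exists s, u|by exists s', u'].
Qed.

End BlockAssembly.

(** * Linear independence on the interior *)

Section Independence.
Variable R : realType.
Variables (alpha beta gamma delta : R) (rho : R -> R).
Hypotheses (lt_alpha_beta : alpha < beta) (lt_gamma_delta : gamma < delta).
Hypothesis rho_gt0 : forall x, alpha < x < beta -> 0 < rho x.

(** For fixed x the combination is a polynomial in t = y / rho(x) that vanishes on
    (gamma, delta), so its coefficients in the graded family B vanish.  These are
    rho(x)^l times a polynomial in x, which therefore vanishes on (alpha, beta).
    The nonvanishing omega stands for the weight of a weighted family. *)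
Lemma koornwinder_free (A : nat -> nat -> {poly R}) (B : nat -> {poly R})
    (g : nat -> nat -> R * R -> R) (omega : R * R -> R) (D : set (R * R)) :
  Omega_int alpha beta gamma delta rho `<=` D ->
  (forall l j, size (A l j) = j.+1) -> (forall l, size (B l) = l.+1) ->
  (forall z, Omega_int alpha beta gamma delta rho z -> omega z != 0) ->
  (forall l j z, Omega_int alpha beta gamma delta rho z -> g l j z =
     omega z * ((A l j).[z.1] * rho z.1 ^+ l * (B l).[z.2 / rho z.1])) ->
  forall N (c : nat -> nat -> R),
    (forall z, D z -> \sum_(l < N) \sum_(j < N - l) c l j * g l j z = 0) ->
    forall l j, (l + j < N)%N -> c l j = 0.
Proof.
move=> OD size_A size_B omega0 gE N c sum0 l j ltN.
pose X l := \sum_(j < N - l) c l j *: A l j.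
apply: (@graded_free _ (A l) (size_A l) (N - l) (c l)); last lia.
apply: (poly_eq0_itv lt_alpha_beta) => x xI; rewrite -/(X l).
have rho_x := rho_gt0 xI; have rho_neq0 := lt0r_neq0 rho_x.
have := @graded_free _ B size_B N (fun l => (X l).[x] * rho x ^+ l) _ l.
move=> /(_ _ _)/eqP; rewrite mulf_eq0 expf_eq0 (negPf rho_neq0) andbF orbF.
move=> H; apply/eqP/H; last lia.
apply: (poly_eq0_itv lt_gamma_delta) => t tI.
have zO : Omega_int alpha beta gamma delta rho (x, rho x * t).
  by split => //=; rewrite ![_ * rho x]mulrC !ltr_pM2l.
have /eqP := sum0 _ (OD _ zO).
rewrite (eq_bigr (fun l : 'I_N => omega (x, rho x * t) *
   ((X l).[x] * rho x ^+ l * (B l).[t]))); last first.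
  move=> i _; rewrite /X horner_sum !mulr_suml mulr_sumr.
  apply: eq_bigr => k _; rewrite gE//= hornerZ [rho x * t]mulrC mulfK//.
  ring.
rewrite -mulr_sumr mulf_eq0 (negPf (omega0 _ zO))/= => /eqP <-.
by rewrite horner_sum; apply: eq_bigr => i _; rewrite hornerZ.
Qed.

End Independence.

(** * Shifting the exponents of the weights *)

Section JacobiWeights.
Variable R : realType.
Implicit Types (lo hi a b s x : R) (weighted : bool).

(** At x = 0 both sides vanish for n > 0, because s + n is then nonzero. *)
Lemma powR_mulXn x s n : 0 <= x -> -1 < s -> x `^ s * x ^+ n = x `^ (s + n%:R).
Proof.
case: n => [|n] x_ge0 s_gt; first by rewrite mulr1 addr0.
rewrite -powR_mulrn// powRD// (_ : (_ == 0) = false)//.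
apply/gt_eqF; rewrite -natr1; have := ler0n R n; lra.
Qed.

Definition boundary_quad lo hi : {poly R} := (hi%:P - 'X) * ('X - lo%:P).

Lemma size_boundary_quad lo hi : (size (boundary_quad lo hi) <= 3)%N.
Proof.
apply: (leq_trans (size_polyMleq _ _)).
by rewrite size_XsubC -opprB size_polyN size_XsubC.
Qed.

Lemma wP_boundary_quad lo hi a b : -1 < a -> -1 < b ->
  {in `[lo, hi], forall x,
    wP lo hi (a + 1) (b + 1) x = (boundary_quad lo hi).[x] * wP lo hi a b x}.
Proof.
move=> a_gt b_gt x; rewrite in_itv/= => /andP[lox xhi].
rewrite /wP /boundary_quad -(powR_mulXn 1 _ a_gt) ?subr_ge0//.
rewrite -(powR_mulXn 1 _ b_gt) ?subr_ge0//.
by rewrite hornerM hornerXsubC hornerD hornerN hornerX hornerC; ring.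
Qed.

(** The factor that multiplies a source polynomial before it is expanded: 1 when
    the exponents are raised, and, in the weighted families, the quotient of the
    source weight by the target weight, whose exponents are lower by 1. *)
Definition shift_factor lo hi weighted : {poly R} :=
  if weighted then boundary_quad lo hi else 1.

Lemma size_shift_factor lo hi weighted :
  (size (shift_factor lo hi weighted) <= weighted.*2.+1)%N.
Proof. by case: weighted; rewrite /= ?size_boundary_quad// size_poly1. Qed.

Lemma shift_factor_wP lo hi weighted a b : -1 < a -> -1 < b ->
  -1 < a + (-1) ^+ weighted -> -1 < b + (-1) ^+ weighted ->
  {in `[lo, hi], forall x,
    (shift_factor lo hi weighted).[x]
    * wP lo hi (a + (-1) ^+ weighted) (b + (-1) ^+ weighted) x =
    (shift_factor lo hi (~~ weighted)).[x] * wP lo hi a b x}.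
Proof.
case: weighted; rewrite /= ?expr1 ?expr0 => a_gt b_gt a'_gt b'_gt x xI;
  rewrite hornerC mul1r.
  by rewrite -[in RHS](subrK 1 a) -[in RHS](subrK 1 b) wP_boundary_quad.
by rewrite wP_boundary_quad.
Qed.

Lemma wP_even (h d y : R) : wP (- h) h d d (- y) = wP (- h) h d d y.
Proof. by rewrite /wP mulrC !opprK; congr (_ `^ _ * _ `^ _); ring. Qed.

Lemma measurable_wP lo hi a b : measurable_fun setT (wP lo hi a b).
Proof.
apply: measurable_funM; apply: (measurableT_comp (measurable_powR _)).
  exact: measurable_funB.
exact: measurable_funB.
Qed.

Lemma shift_factor_even (h : R) weighted :
  shift_factor (- h) h weighted \Po (- 'X) = shift_factor (- h) h weighted.
Proof.
case: weighted; rewrite /= ?comp_polyC// /boundary_quad comp_polyM !linearB/=.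
rewrite !comp_polyC comp_polyX polyCN.
ring.
Qed.

End JacobiWeights.

(** * Powers of rho as polynomials *)

Section RhoPowers.
Variables (R : realType) (eta : bool) (r : {poly R}).

(** For e <= 2 this agrees with rho^e on [alpha, beta], except for e = 1 in
    case (ii), where rho need not be a polynomial. *)
Definition rho_pow (e : nat) : {poly R} :=
  match e with 0%N => 1 | 1%N => r | _ => rho_sq eta r end.

(** With d2 the degree of rho^2, the degree of rho^e is at most e + d2 - 2: for
    e = 0 this is d2 >= 2, for e = 1 it is d0 + 1 <= 2 d0, and for e = 2 it is an
    equality. *)
Lemma size_rho_pow e :
  (2 + eta <= deg r)%N -> (e <= 2)%N -> ~~ ((e == 1%N) && eta) ->
  (size (rho_pow e) < e + deg (rho_sq eta r))%N.
Proof.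
move=> deg_r.
have size_r : size r = (deg r).+1.
  by rewrite /deg prednK//; move: deg_r; rewrite /deg; case: size => //; case: eta.
have deg_sq : (deg (rho_sq eta r) = if eta then deg r else (deg r).*2)%N.
  case: (eta) => //=; rewrite /rho_sq/= /deg expr2 size_mul -?size_poly_gt0 ?size_r//.
  by rewrite /deg; lia.
have size_sq : size (rho_sq eta r) = (deg (rho_sq eta r)).+1.
  rewrite [RHS]prednK// size_poly_gt0 /rho_sq.
  by case: ifP; rewrite ?expf_eq0 -size_poly_gt0 size_r.
case: e => [|[|[|//]]] _ /=; last by rewrite size_sq; lia.
  by rewrite size_poly1 deg_sq; move: deg_r; clear; case: eta => /=; lia.
by rewrite size_r deg_sq; move: deg_r; clear; case: eta => //=; lia.
Qed.

End RhoPowers.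

Section Rho.
Variables (R : realType) (alpha beta gamma delta : R) (rho : R -> R).
Hypothesis lt_alpha_beta : alpha < beta.
Hypothesis rho_gt0 : forall x, alpha < x < beta -> 0 < rho x.
Variables (eta : bool) (r : {poly R}).
Hypothesis rhoE : rho_case alpha beta gamma delta rho eta r.

Lemma rho_ge0 x : alpha <= x <= beta -> 0 <= rho x.
Proof.
move: x; have := rhoE; rewrite /rho_case.
case: (eta) => [[rhoS _ _] x /rhoS->|rhoP x xI].
  exact: sqrtr_ge0.
rewrite rhoP//; apply: (poly_ge0_closure lt_alpha_beta) xI => y yI.
by rewrite -rhoP ?rho_gt0//; lra.
Qed.

Lemma rho_sqE x : alpha <= x <= beta -> rho x ^+ 2 = (rho_sq eta r).[x].
Proof.
move: x; have := rhoE; rewrite /rho_case /rho_sq.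
case: (eta) => [[rhoS _ _] x xI|rhoP x xI]; last by rewrite rhoP// horner_exp.
rewrite rhoS// sqr_sqrtr//; apply: (poly_ge0_closure lt_alpha_beta) xI => y yI.
by rewrite -sqrtr_gt0 -rhoS ?rho_gt0//; lra.
Qed.

Lemma rho_powE e x : (e <= 2)%N -> ~~ ((e == 1%N) && eta) -> alpha <= x <= beta ->
  rho x ^+ e = (rho_pow eta r e).[x].
Proof.
case: e => [|[|[|//]]] _ /=; first by rewrite hornerC.
  by move=> eta0 xI; have := rhoE; rewrite /rho_case (negPf eta0) => ->.
by move=> _; exact: rho_sqE.
Qed.

End Rho.

(** * The conversions *)

Section Koornwinder.
Variables (R : realType) (alpha beta gamma delta : R) (rho : R -> R).
Hypotheses (lt_alpha_beta : alpha < beta) (lt_gamma_delta : gamma < delta).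
Hypothesis rho_gt0 : forall x, alpha < x < beta -> 0 < rho x.
Variable RR : R -> R -> R -> nat -> {poly R}.
Hypothesis RR_on : forall a b s : R,
  weight_integrable alpha beta (wR alpha beta rho a b s) ->
  orthonormal_polys alpha beta (wR alpha beta rho a b s) (RR a b s).
Variable PP : R -> R -> nat -> {poly R}.
Hypothesis PP_on : forall d c : R,
  weight_integrable gamma delta (wP gamma delta d c) ->
  orthonormal_polys gamma delta (wP gamma delta d c) (PP d c).

Local Notation adm := (admissible alpha beta gamma delta rho).
Local Notation Omo := (Omega_int alpha beta gamma delta rho).

Definition rho_exponent (c d : R) (k : nat) : R := c + d + (2 * k + 1)%:R.

Definition koornwinder_entry a b c d (k i : nat) (z : R * R) : R :=
  (RR a b (rho_exponent c d k) i).[z.1] * rho z.1 ^+ k * (PP d c k).[z.2 / rho z.1].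

Lemma rho_exponent_gt c d k : -1 < c -> -1 < d -> -1 < rho_exponent c d k.
Proof. by rewrite /rho_exponent natrD => c_gt d_gt; have := ler0n R (2 * k); lra. Qed.

Lemma RR_adm a b c d k : adm a b c d ->
  weight_integrable alpha beta (wR alpha beta rho a b (rho_exponent c d k)) /\
  orthonormal_polys alpha beta (wR alpha beta rho a b (rho_exponent c d k))
    (RR a b (rho_exponent c d k)).
Proof. by move=> [_ _ + _] => /(_ k) wint; split => //; exact: RR_on. Qed.

Lemma PP_adm a b c d : adm a b c d ->
  weight_integrable gamma delta (wP gamma delta d c) /\
  orthonormal_polys gamma delta (wP gamma delta d c) (PP d c).
Proof. by move=> [_ _ _ wint]; split => //; exact: PP_on. Qed.

Lemma koornwinder_entry_free a b c d (g : nat -> nat -> R * R -> R)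
    (omega : R * R -> R) D :
  adm a b c d -> Omo `<=` D ->
  (forall z, Omo z -> omega z != 0) ->
  (forall l j z, Omo z -> g l j z = omega z * koornwinder_entry a b c d l j z) ->
  forall N (e : nat -> nat -> R),
    (forall z, D z -> \sum_(l < N) \sum_(j < N - l) e l j * g l j z = 0) ->
    forall l j, (l + j < N)%N -> e l j = 0.
Proof.
move=> ad OD omega0 gE.
apply: (koornwinder_free lt_alpha_beta lt_gamma_delta rho_gt0 OD _ _ omega0 gE).
  by move=> l j; have [_ []] := RR_adm l ad.
by move=> l; have [_ []] := PP_adm ad.
Qed.

Section VerticalBoundaries.
Variables (weighted : bool) (a b c d : R).
Let a' := a + (-1) ^+ weighted.
Let b' := b + (-1) ^+ weighted.
Let u := shift_factor alpha beta weighted.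
Hypotheses (ad : adm a b c d) (ad' : adm a' b' c d).

Definition side_coef l k j i : R :=
  (l == k)%:R * connection alpha beta (wR alpha beta rho a' b' (rho_exponent c d k)) u
    (RR a b (rho_exponent c d k)) (RR a' b' (rho_exponent c d k)) j i.

(** The factor rho^s is common to both weights. *)
Lemma side_weight k : {in `[alpha, beta], forall x,
  u.[x] * wR alpha beta rho a' b' (rho_exponent c d k) x =
  (shift_factor alpha beta (~~ weighted)).[x]
  * wR alpha beta rho a b (rho_exponent c d k) x}.
Proof.
have [[a_gt b_gt _ _] _ _ _] := ad; have [[a'_gt b'_gt _ _] _ _ _] := ad'.
move=> x xI; rewrite /wR mulrA [RHS]mulrA; congr (_ * _).
exact: (shift_factor_wP a_gt b_gt a'_gt b'_gt xI).
Qed.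

(** The factors in y of source and target coincide, so only k = l contributes.
    The function omega is 1 for the plain families and the target weight for the
    weighted ones. *)
Lemma side_conversion (omega : R * R -> R) D (f g : nat -> nat -> R * R -> R) :
  Omo `<=` D ->
  (forall z, Omo z -> omega z != 0) ->
  (forall k i z, D z ->
     f k i z = omega z * (u.[z.1] * koornwinder_entry a b c d k i z)) ->
  (forall l j z, D z -> g l j z = omega z * koornwinder_entry a' b' c d l j z) ->
  banded_conversion D (block_row_of f) (block_row_of g)
    weighted.*2 (~~ weighted).*2 0 0.
Proof.
move=> OD omega0 fE gE.
apply: (@banded_conversion_coef _ _ _ _ side_coef).
- by apply: (koornwinder_entry_free ad' OD omega0) => l j z /OD; exact: gE.
- move=> l k j i; rewrite /side_coef.
  have [->|_] := eqVneq l k; last by rewrite mul0r eqxx.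
  rewrite mul1r => C_neq0; have [wint on] := RR_adm k ad.
  have [wint' on'] := RR_adm k ad'.
  have := size_shift_factor alpha beta weighted.
  have := size_shift_factor alpha beta (~~ weighted).
  have low : ~~ (size u + i <= j)%N.
    by apply: contra C_neq0 => ?; rewrite (connection_high wint' on).
  have high : ~~ (size (shift_factor alpha beta (~~ weighted)) + j <= i)%N.
    by apply: contra C_neq0 => ?; rewrite (connection_low wint on on' (side_weight k)).
  by rewrite -/u; split; lia.
move=> k i N z ltN Dz; have ltkN : (k < N)%N by lia.
rewrite (bigD1 (Ordinal ltkN))//= [X in _ + X]big1 ?addr0; last first.
  move=> l /negPf lk; apply: big1 => j _.
  by rewrite /side_coef (_ : (l == k :> nat) = false) ?mul0r.
have [wint on] := RR_adm k ad; have [wint' on'] := RR_adm k ad'.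
rewrite fE// /koornwinder_entry !mulrA -[_ * _ * (RR _ _ _ _).[_]]mulrA.
rewrite (connection_horner z.1 wint' on on' (M := (N - k)%N)); last first.
  by have := size_shift_factor alpha beta weighted; rewrite -/u; lia.
rewrite mulr_sumr !mulr_suml; apply: eq_bigr => j _.
by rewrite gE// /side_coef eqxx mul1r /koornwinder_entry; ring.
Qed.

End VerticalBoundaries.

Variables (eta : bool) (r : {poly R}).
Hypothesis rhoE : rho_case alpha beta gamma delta rho eta r.
Hypothesis deg_r : (2 + eta <= deg r)%N.

Local Notation d2 := (deg (rho_sq eta r)).

Lemma complementary_power e : (e <= 2)%N -> ~~ ((e == 1%N) && eta) ->
  ~~ ((2 - e == 1)%N && eta).
Proof. by case: e => [|[|[|]]]. Qed.

Section CurvedBoundaries.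
Variables (weighted : bool) (a b c d : R).
Hypothesis eq_cd : eta -> c = d.
Let c' := c + (-1) ^+ weighted.
Let d' := d + (-1) ^+ weighted.
Let u := shift_factor gamma delta weighted.
Hypotheses (ad : adm a b c d) (ad' : adm a b c' d').

Definition curve_ycoef l k : R :=
  connection gamma delta (wP gamma delta d' c') u (PP d c) (PP d' c') l k.

Definition curve_xcoef l k j i : R :=
  connection alpha beta (wR alpha beta rho a b (rho_exponent c' d' l))
    (rho_pow eta r (k + weighted.*2 - l))
    (RR a b (rho_exponent c d k)) (RR a b (rho_exponent c' d' l)) j i.

(** The exponent e = k + weighted.*2 - l of rho that is left over lies between 0
    and 2 by the two degree bounds, and in case (ii) it is not 1, by parity. *)
Lemma curve_ycoef_neq0 l k : curve_ycoef l k != 0 ->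
  [/\ (l <= k + weighted.*2)%N, (k <= l + (~~ weighted).*2)%N &
      ~~ ((k + weighted.*2 - l == 1)%N && eta)].
Proof.
have [[_ _ c_gt d_gt] _ _ _] := ad; have [[_ _ c'_gt d'_gt] _ _ _] := ad'.
have [wint on] := PP_adm ad; have [wint' on'] := PP_adm ad'.
move=> C_neq0.
have := size_shift_factor gamma delta weighted.
have := size_shift_factor gamma delta (~~ weighted).
have low : ~~ (size u + k <= l)%N.
  by apply: contra C_neq0 => ?; rewrite /curve_ycoef (connection_high wint' on).
have high : ~~ (size (shift_factor gamma delta (~~ weighted)) + l <= k)%N.
  apply: contra C_neq0 => ?.
  rewrite /curve_ycoef.
  by rewrite (connection_low wint on on' (shift_factor_wP d_gt c_gt d'_gt c'_gt)).
rewrite -/u => size_v size_u; split; try lia.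
apply/negP => /andP[/eqP e1 eta1]; move: C_neq0.
have gammaE : gamma = - delta.
  by have := rhoE; rewrite /rho_case eta1 => -[_ -> _]; rewrite opprK.
have c'E : c' = d' by rewrite /c' /d' eq_cd.
move: (eq_cd eta1) => cE; move: wint on wint' on'.
rewrite /curve_ycoef /u c'E cE gammaE => wint on wint' on'.
rewrite (connection_parity _ (wP_even _ _) wint _ (wP_even _ _) wint' _ on on') ?eqxx//.
- exact: measurable_wP.
- exact: measurable_wP.
- exact: shift_factor_even.
- by move: e1; clear; lia.
Qed.

(** The exponents of rho satisfy s'_l + e = s_k + 2 - e, where s'_l is s_l for the
    shifted parameters. *)
Lemma curve_weight l k : (l <= k + weighted.*2)%N -> (k <= l + (~~ weighted).*2)%N ->
  ~~ ((k + weighted.*2 - l == 1)%N && eta) ->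
  {in `[alpha, beta], forall x,
    (rho_pow eta r (k + weighted.*2 - l)).[x]
    * wR alpha beta rho a b (rho_exponent c' d' l) x =
    (rho_pow eta r (2 - (k + weighted.*2 - l))).[x]
    * wR alpha beta rho a b (rho_exponent c d k) x}.
Proof.
move=> lk kl eta1 x; rewrite in_itv/= => xI.
have [[_ _ c_gt d_gt] _ _ _] := ad; have [[_ _ c'_gt d'_gt] _ _ _] := ad'.
set e := (k + weighted.*2 - l)%N in eta1 *.
have le2 : (e <= 2)%N by rewrite /e; move: kl; case: weighted; rewrite /=; lia.
have eta1' : ~~ ((2 - e == 1)%N && eta) by exact: complementary_power.
have rhox := rho_ge0 lt_alpha_beta rho_gt0 rhoE xI.
have powE e' : (e' <= 2)%N -> ~~ ((e' == 1)%N && eta) ->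
    rho x ^+ e' = (rho_pow eta r e').[x].
  by move=> e'2 e'1; exact: (rho_powE lt_alpha_beta rho_gt0 rhoE).
rewrite -!powE ?leq_subr// /wR ![rho x ^+ _ * _]mulrC -!mulrA; do 2 congr (_ * _).
rewrite !powR_mulXn ?rho_exponent_gt//; congr (_ `^ _).
have eE : e%:R = k%:R + weighted.*2%:R - l%:R :> R by rewrite /e natrB// natrD.
rewrite /rho_exponent /c' /d' (natrB _ le2) eE !natrD.
have -> : (-1) ^+ weighted = 1 - weighted.*2%:R :> R.
  by case: (weighted); rewrite ?expr1 ?expr0 -muln2 natrM /=; ring.
ring.
Qed.

(** With tau = weighted.*2 and e = k + tau - l, the block index moves by
    l + j - (k + i) = (j - i) + tau - e, and the univariate conversion in x gives
    - deg rho^(2 - e) <= j - i <= deg rho^e.  By [size_rho_pow] the move is at most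
    tau + d2 - 2, and at least tau - d2. *)
Lemma curve_conversion (omega : R * R -> R) D (f g : nat -> nat -> R * R -> R) :
  Omo `<=` D ->
  (forall z, D z -> alpha <= z.1 <= beta) ->
  (forall z, Omo z -> omega z != 0) ->
  (forall k i z, D z ->
     f k i z = omega z * (rho z.1 ^+ weighted.*2 * u.[z.2 / rho z.1]
                          * koornwinder_entry a b c d k i z)) ->
  (forall l j z, D z -> g l j z = omega z * koornwinder_entry a b c' d' l j z) ->
  banded_conversion D (block_row_of f) (block_row_of g)
    (d2 + weighted.*2 - 2) (d2 - weighted.*2) weighted.*2 (~~ weighted).*2.
Proof.
move=> OD Dx omega0 fE gE.
have size_pow e : (e <= 2)%N -> ~~ ((e == 1)%N && eta) ->
    (size (rho_pow eta r e) < e + d2)%N.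
  by move=> le2 eta1; apply: size_rho_pow.
have d2_ge2 : (2 <= d2)%N.
  by have := size_pow 0 isT isT; rewrite /= size_poly1.
apply: (@banded_conversion_coef _ _ _ _
  (fun l k j i => curve_ycoef l k * curve_xcoef l k j i)).
- by apply: (koornwinder_entry_free ad' OD omega0) => l j z /OD; exact: gE.
- move=> l k j i; rewrite mulf_eq0 negb_or.
  move=> /andP[/curve_ycoef_neq0[lk kl eta1] X_neq0].
  have [wint on] := RR_adm k ad; have [wint' on'] := RR_adm l ad'.
  set e := (k + weighted.*2 - l)%N in eta1.
  have low : ~~ (size (rho_pow eta r e) + i <= j)%N.
    by apply: contra X_neq0 => ?; rewrite /curve_xcoef (connection_high wint' on).
  have high : ~~ (size (rho_pow eta r (2 - e)) + j <= i)%N.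
    apply: contra X_neq0 => ?; rewrite /curve_xcoef.
    by rewrite (connection_low wint on on' (curve_weight lk kl eta1)).
  have le2 : (e <= 2)%N by rewrite /e; move: kl; case: weighted; rewrite /=; lia.
  have eta1' : ~~ ((2 - e == 1)%N && eta) by exact: complementary_power.
  have := size_pow e le2 eta1; have := size_pow _ (leq_subr e 2) eta1'.
  move: low high le2; rewrite /e; move: kl lk d2_ge2; clear.
  by case: weighted => /=; split; lia.
move=> k i N z ltN Dz; have [wint on] := PP_adm ad; have [wint' on'] := PP_adm ad'.
transitivity (omega z * \sum_(l < N) curve_ycoef l k *
    ((RR a b (rho_exponent c d k) i).[z.1] * rho z.1 ^+ (k + weighted.*2) *
     (PP d' c' l).[z.2 / rho z.1])).
  have yE := connection_horner (z.2 / rho z.1) (u := u) (M := N) (n := k) wint' on on'.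
  rewrite fE// /koornwinder_entry.
  transitivity (omega z * ((RR a b (rho_exponent c d k) i).[z.1]
     * rho z.1 ^+ (k + weighted.*2) *
     (u.[z.2 / rho z.1] * (PP d c k).[z.2 / rho z.1]))).
    by rewrite exprD; ring.
  rewrite yE; last first.
    have := size_shift_factor gamma delta weighted.
    by rewrite -/u; move: ltN d2_ge2; clear; lia.
  congr (_ * _); rewrite mulr_sumr; apply: eq_bigr => l _; rewrite /curve_ycoef.
  ring.
rewrite mulr_sumr; apply: eq_bigr => l _.
have [->|/curve_ycoef_neq0[lk kl eta1]] := eqVneq (curve_ycoef l k) 0.
  by rewrite mul0r mulr0 big1// => j _; rewrite !mul0r.
have [wintx onx] := RR_adm k ad; have [wintx' onx'] := RR_adm l ad'.
set e := (k + weighted.*2 - l)%N in eta1.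
have le2 : (e <= 2)%N by rewrite /e; move: kl; case: weighted; rewrite /=; lia.
have -> : rho z.1 ^+ (k + weighted.*2) = (rho_pow eta r e).[z.1] * rho z.1 ^+ l.
  by rewrite -(rho_powE lt_alpha_beta rho_gt0 rhoE le2 eta1 (Dx z Dz)) -exprD subnK.
transitivity (omega z * curve_ycoef l k *
    ((rho_pow eta r e).[z.1] * (RR a b (rho_exponent c d k) i).[z.1]) *
    (rho z.1 ^+ l * (PP d' c' l).[z.2 / rho z.1])); first by ring.
rewrite (connection_horner z.1 wintx' onx onx' (M := (N - l)%N)); last first.
  have := size_pow e le2 eta1; move: ltN lk d2_ge2; rewrite /e; clear; lia.
rewrite mulr_sumr mulr_suml; apply: eq_bigr => j _.
by rewrite gE// /koornwinder_entry /curve_xcoef -/e; ring.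
Qed.

End CurvedBoundaries.

End Koornwinder.

(** * Weights on the interior *)

Section InteriorWeight.
Variables (R : realType) (alpha beta gamma delta : R) (rho : R -> R).
Implicit Types (a b c d x s : R) (z : R * R).

Local Notation Omo := (Omega_int alpha beta gamma delta rho).
Local Notation weight := (Defs.weight alpha beta gamma delta rho).

Lemma weight_neq0 a b c d z : Omo z -> weight a b c d z != 0.
Proof.
move=> -[/andP[az zb] /andP[gz zd]].
by rewrite /Defs.weight !mulf_neq0//; apply/lt0r_neq0/powR_gt0; rewrite subr_gt0.
Qed.

Lemma powR_pred x s : 0 < x -> x `^ s = x `^ (s - 1) * x.
Proof.
move=> x_gt0; rewrite -{1}(subrK 1 s) [LHS]powRD ?lt0r_neq0 ?implybT//.
by rewrite powRr1// ltW.
Qed.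

Lemma weight_side a b c d z : Omo z ->
  weight a b c d z = weight (a - 1) (b - 1) c d z * (boundary_quad alpha beta).[z.1].
Proof.
move=> -[/andP[az zb] _]; rewrite /Defs.weight (powR_pred a) ?subr_gt0//.
rewrite (powR_pred b) ?subr_gt0//.
rewrite /boundary_quad hornerM hornerXsubC hornerD hornerN hornerX hornerC; ring.
Qed.

(** With t = y / rho, the product of y - gamma rho and delta rho - y is
    rho^2 (t - gamma)(delta - t). *)
Lemma weight_curve a b c d z : 0 < rho z.1 -> Omo z ->
  weight a b c d z = weight a b (c - 1) (d - 1) z *
    (rho z.1 ^+ 2 * (boundary_quad gamma delta).[z.2 / rho z.1]).
Proof.
move=> rho_gt0 [_ /andP[gz zd]]; rewrite /Defs.weight (powR_pred c) ?subr_gt0//.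
rewrite (powR_pred d) ?subr_gt0//.
rewrite /boundary_quad hornerM hornerXsubC hornerD hornerN hornerX hornerC.
by have := lt0r_neq0 rho_gt0 => ?; field.
Qed.

End InteriorWeight.

Lemma weighted_koornwinderE (R : realType) (alpha beta gamma delta : R) (rho : R -> R)
    RR PP (a b c d : R) :
  weighted_koornwinder alpha beta gamma delta rho RR PP a b c d =
  block_row_of (fun k i z => weight alpha beta gamma delta rho a b c d z *
                             koornwinder_entry rho RR PP a b c d k i z).
Proof.
apply: functional_extensionality_dep => n; apply: functional_extensionality_dep => z.
by apply/rowP => k; rewrite !mxE.
Qed.

Theorem proposition5p7 (R : realType) (alpha beta gamma delta : R)
  (lt_alpha_beta : alpha < beta) (lt_gamma_delta : gamma < delta)
  (rho : R -> R) (rho_gt0 : forall x, alpha < x < beta -> 0 < rho x)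
  (eta : bool) (r : {poly R})
  (rhoE : rho_case alpha beta gamma delta rho eta r)
  (deg_r : (2 + eta <= deg r)%N)
  (RR : R -> R -> R -> nat -> {poly R})
  (RR_orthonormal : forall a b s : R,
     weight_integrable alpha beta (wR alpha beta rho a b s) ->
     orthonormal_polys alpha beta (wR alpha beta rho a b s) (RR a b s))
  (PP : R -> R -> nat -> {poly R})
  (PP_orthonormal : forall d c : R,
     weight_integrable gamma delta (wP gamma delta d c) ->
     orthonormal_polys gamma delta (wP gamma delta d c) (PP d c))
  (a b c d : R) (eq_cd : eta -> c = d) :
  let Om := Omega alpha beta gamma delta rho in
  let Omo := Omega_int alpha beta gamma delta rho in
  let adm := admissible alpha beta gamma delta rho in
  let H := koornwinder rho RR PP in
  let W := weighted_koornwinder alpha beta gamma delta rho RR PP in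
  let d2 := deg (rho_sq eta r) in
  adm a b c d ->
  [/\ adm (a + 1) (b + 1) c d ->
        banded_conversion Om (H a b c d) (H (a + 1) (b + 1) c d) 0 2 0 0,
      adm a b (c + 1) (d + 1) ->
        banded_conversion Om (H a b c d) (H a b (c + 1) (d + 1))
          (d2 - 2) d2 0 2,
      adm (a - 1) (b - 1) c d ->
        banded_conversion Omo (W a b c d) (W (a - 1) (b - 1) c d) 2 0 0 0
    & adm a b (c - 1) (d - 1) ->
        banded_conversion Omo (W a b c d) (W a b (c - 1) (d - 1))
          d2 (d2 - 2) 2 0].
Proof.
move=> Om Omo adm H W d2 ad.
have OmoOm : Omo `<=` Om.
  by move=> z [/andP[az zb] /andP[gz zd]]; split; rewrite !ltW.
have HE a' b' c' d' :
  H a' b' c' d' = block_row_of (koornwinder_entry rho RR PP a' b' c' d') by [].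
have one_neq0 z : Omo z -> (1 : R) != 0 by rewrite oner_neq0.
split=> ad'.
- rewrite !HE; apply: (side_conversion lt_alpha_beta lt_gamma_delta rho_gt0
    RR_orthonormal PP_orthonormal
    (weighted := false) ad ad' (omega := (fun=> 1))) => //.
  + by move=> k i z _; rewrite /= hornerC !mul1r.
  + by move=> l j z _; rewrite mul1r.
- rewrite !HE; have := curve_conversion lt_alpha_beta lt_gamma_delta rho_gt0
    RR_orthonormal PP_orthonormal rhoE deg_r (weighted := false) eq_cd ad ad'
    (omega := (fun=> 1)).
  rewrite /= addn0 subn0; apply => //.
  + by move=> z [].
  + by move=> k i z _; rewrite /= hornerC !mul1r.
  + by move=> l j z _; rewrite mul1r.
- rewrite /W !weighted_koornwinderE.
  apply: (side_conversion lt_alpha_beta lt_gamma_delta rho_gt0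
    RR_orthonormal PP_orthonormal
    (weighted := true) ad ad'
    (omega := (weight alpha beta gamma delta rho (a - 1) (b - 1) c d))) => //.
  + exact: weight_neq0.
  + by move=> k i z Oz; rewrite (weight_side _ _ _ _ Oz) -mulrA.
- rewrite /W !weighted_koornwinderE.
  have := curve_conversion lt_alpha_beta lt_gamma_delta rho_gt0
    RR_orthonormal PP_orthonormal rhoE deg_r (weighted := true) eq_cd ad ad'
    (omega := (weight alpha beta gamma delta rho a b (c - 1) (d - 1))).
  rewrite /= addnK; apply => //.
  + by move=> z /OmoOm[].
  + exact: weight_neq0.
  + by move=> k i z Oz; rewrite (weight_curve _ _ _ _ (rho_gt0 _ Oz.1) Oz) -mulrA.
Qed.
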